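(* In the setting described in the context (a simple algebraic extension $(L|K,v)$ with $vL=vK$, a complete sequence of key polynomials $\{Q_i(\eta)\}_{i\in I}$ for it, and the associated final segments $\alpha,\beta$ of $\Gamma_\infty$), assume that the $\mathcal{O}_L$-module homomorphism $\Omega\to I_\alpha/I_\beta$ sending $d\tilde Q_i(\eta)$ to $Q_i'(\eta)/a_i+I_\beta$ for $i\in I$ is an isomorphism, and assume that $\Omega\ne(0)$. Then $\Omega$ is finitely generated as an $\mathcal{O}_L$-module if and only if $\alpha$ has a smallest element.
   Context: Let $(L|K,v)$ be a simple algebraic extension of valued fields with $vL=vK$, written $L=K(\eta)$, and let $g\in K[x]$ be the minimal polynomial of $\eta$ over $K$. $\mathcal{O}_L,\mathcal{O}_K$ are the valuation rings, $\Gamma=vL$, $\Gamma_\infty=\Gamma\cup\{\infty\}$, and $\Omega$ is the $\mathcal{O}_L$-module of Kähler differentials of $\mathcal{O}_L|\mathcal{O}_K$. For $S\subseteq\Gamma_\infty$, $I_S=\{b\in L\mid \exists s\in S:\ vb\ge s\}$, an $\mathcal{O}_L$-submodule of $L$ (with $I_\emptyset=\{0\}$). Let $\nu(f)=v(f(\eta))$ for $f\in K[x]$; fix an extension of $\nu$ to $\overline K[x]$, again denoted $\nu$. For $f\in K[x]\setminus K$ put $\delta(f)=\max\{\nu(x-a)\mid f(a)=0\}$. A monic polynomial $Q\in K[x]\setminus K$ is a key polynomial for $\nu$ if for every $f\in K[x]\setminus K$, $\delta(f)\ge\delta(Q)$ implies $\deg f\ge\deg Q$. For non-constant $q$ and $q$-expansion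 $f=f_0+\ldots+f_rq^r$ ($\deg f_\ell<\deg q$), $\nu_q(f)=\min_\ell\nu(f_\ell q^\ell)$. A set of non-constant polynomials is complete for $\nu$ if for every non-constant $f\in K[x]$ it contains some $q$ with $\deg q\le\deg f$ and $\nu_q(f)=\nu(f)$. Let $\{Q_i\}_{i\in I}\cup\{g\}$ be a complete set of key polynomials for $\nu$, with $I$ well-ordered with initial element $0$, $i<j\Rightarrow\delta(Q_i)<\delta(Q_j)$, $\nu(Q_i)<\infty$ for all $i\in I$, $Q_0=x$ and $\nu(x)=0$ (one then says $\{Q_i(\eta)\}_{i\in I}$ is a complete sequence of key polynomials for $(L|K,v)$). For each $i\in I$ choose $a_i\in K$ with $v(a_i)=\nu(Q_i)$ (with $a_0=1$) and put $\tilde Q_i=Q_i/a_i$. With $f'$ the formal derivative, put $\alpha_i=\nu(Q_i')-\nu(Q_i)$ and $\beta_i=\nu(g')-\nu_{Q_i}(g)$ in $\Gamma_\infty$, and let $\alpha$, $\beta$ be the smallest final segments of $\Gamma_\infty$ containing $\{\alpha_i\mid i\in I\}$ and $\{\beta_i\mid i\in I\}$, respectively. *)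

(* Defs.v *)
From HB Require Import structures.
From mathcomp Require Import all_boot all_order all_algebra all_field.
From mathcomp Require Import ring_quotient.
From mathcomp Require Import boolp classical_sets wochoice.

Set Implicit Arguments.
Unset Strict Implicit.
Unset Printing Implicit Defensive.

Import Order.TTheory GRing.Theory.

Local Open Scope ring_scope.
Local Open Scope classical_set_scope.
Local Open Scope quotient_scope.

HB.mixin Record POrderedZmodule_isOrdered G of Num.POrderedZmodule G := {
  leg_total : total (<=%O : rel G);
  leg_add2r : forall z x y : G, x <= y -> x + z <= y + z
}.

#[short(type="orderedZmodType")]
HB.structure Definition OrderedZmodule :=
  { G of Num.POrderedZmodule G & POrderedZmodule_isOrdered G }.

Variant withinf (G : Type) : Type := Fin of G | infty.
Arguments infty {G}.

Definition inf_map (G G' : Type) (f : G -> G') (x : withinf G) : withinf G' :=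
  if x is Fin a then Fin (f a) else infty.

Section WithInf.
Variable G : orderedZmodType.
Implicit Types x y z : withinf G.

Definition inf_to_option x : option G := if x is Fin a then Some a else None.
Definition inf_of_option (o : option G) : withinf G :=
  if o is Some a then Fin a else infty.
Fact inf_to_optionK : cancel inf_to_option inf_of_option.
Proof. by case. Qed.

HB.instance Definition _ := Choice.copy (withinf G) (can_type inf_to_optionK).

Definition inf_le x y : bool :=
  match x, y with
  | _, infty => true
  | infty, Fin _ => false
  | Fin a, Fin b => a <= b
  end.

Fact inf_le_anti : antisymmetric inf_le.
Proof. by move=> [a|] [b|] //= /le_anti ->. Qed.

Fact inf_le_trans : transitive inf_le.
Proof. by move=> [b|] [a|] [c|] //=; apply: le_trans. Qed.

Fact inf_le_total : total inf_le.
Proof. by move=> [a|] [b|] //=; apply: leg_total. Qed.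

Fact inf_le_refl : reflexive inf_le.
Proof. by move=> [a|] /=. Qed.

HB.instance Definition _ := Order.Le_isPOrder.Build ring_display (withinf G)
  inf_le_refl inf_le_anti inf_le_trans.
HB.instance Definition _ :=
  Order.POrder_isTotal.Build ring_display (withinf G) inf_le_total.

Definition inf_add x y : withinf G :=
  match x, y with Fin a, Fin b => Fin (a + b) | _, _ => infty end.

(* Meaningful only when [y] is finite; then [infty - y = infty]. *)
Definition inf_sub x y : withinf G :=
  match x, y with Fin a, Fin b => Fin (a - b) | _, _ => infty end.

Definition final_segment (S : set (withinf G)) : Prop :=
  forall x y, S x -> x <= y -> S y.

Definition has_least (S : set (withinf G)) : Prop :=
  exists2 m, S m & forall x, S x -> m <= x.

End WithInf.

(* The support [v^-1(infty)] is allowed to be a nonzero prime ideal, as is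
   needed on polynomial rings; over a field it is zero ([val_eq_infty]). *)
Record valuation (R : nzRingType) (G : orderedZmodType) := Valuation {
  val_fun :> R -> withinf G;
  val0 : val_fun 0 = infty;
  val1 : val_fun 1 = Fin 0;
  valM : forall x y, val_fun (x * y) = inf_add (val_fun x) (val_fun y);
  valD : forall x y, Order.min (val_fun x) (val_fun y) <= val_fun (x + y)
}.

Section Pullback.
Variables (R S : nzRingType) (G : orderedZmodType).
Variables (f : {rmorphism R -> S}) (v : valuation S G).

Fact pull0 : v (f 0) = infty. Proof. by rewrite rmorph0 val0. Qed.
Fact pull1 : v (f 1) = Fin 0. Proof. by rewrite rmorph1 val1. Qed.
Fact pullM x y : v (f (x * y)) = inf_add (v (f x)) (v (f y)).
Proof. by rewrite rmorphM valM. Qed.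
Fact pullD x y : Order.min (v (f x)) (v (f y)) <= v (f (x + y)).
Proof. by rewrite rmorphD valD. Qed.

Definition val_pull : valuation R G :=
  @Valuation R G (fun x => v (f x)) pull0 pull1 pullM pullD.

End Pullback.

Section ValuationRing.
Variables (R : comNzRingType) (G : orderedZmodType) (v : valuation R G).

Lemma addg_eq0 (a : G) : a + a = 0 -> a = 0.
Proof.
move=> aa0; apply: le_anti; have aN : a = - a by apply/eqP; rewrite -addr_eq0 aa0.
have /orP[a0|a0] := leg_total a 0; rewrite a0 /=.
  by have := leg_add2r (- a) _ _ a0; rewrite subrr add0r -aN.
by have := leg_add2r (- a) _ _ a0; rewrite subrr add0r -aN => ->.
Qed.

Lemma valN1 : v (- 1) = Fin 0.
Proof.
have : v (- 1 * - 1) = Fin 0 by rewrite mulN1r opprK val1.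
rewrite valM; by case: (v (- 1)) => //= a [/addg_eq0->].
Qed.

Lemma valN x : v (- x) = v x.
Proof. by rewrite -mulN1r valM valN1; case: (v x) => //= a; rewrite add0r. Qed.

Lemma valB x y : Order.min (v x) (v y) <= v (x - y).
Proof. by rewrite -(valN y) valD. Qed.

Definition vring_pred : {pred R} := fun x => Fin 0 <= v x.

Fact vring_subring : subring_closed vring_pred.
Proof.
split=> [|x y|x y]; rewrite /in_mem /= /vring_pred; first by rewrite val1.
  by move=> x0 y0; apply: le_trans (valB x y); rewrite le_min x0.
rewrite valM; case: (v x) (v y) => [a|] [b|] //=.
rewrite /Order.le /= => a0 b0; apply: le_trans b0 _.
by rewrite -[leLHS]add0r; apply: leg_add2r.
Qed.

HB.instance Definition _ := GRing.isSubringClosed.Build R vring_pred vring_subring.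

Record vring : Type := VRing { vring_val : R; _ : vring_val \in vring_pred }.

HB.instance Definition _ := [isSub for vring_val].
HB.instance Definition _ := [Choice of vring by <:].
HB.instance Definition _ := [SubChoice_isSubComNzRing of vring by <:].

End ValuationRing.

(* For [f := in_alg L] this is the inclusion of the valuation ring of the base
   field into that of [L]. *)
Section ValuationRingMap.
Variables (R S : comNzRingType) (G : orderedZmodType).
Variables (f : {rmorphism R -> S}) (v : valuation S G).

Fact vring_map_subproof (x : vring (val_pull f v)) : f (val x) \in vring_pred v.
Proof. exact: (valP x). Qed.

Definition vring_map (x : vring (val_pull f v)) : vring v :=
  VRing (vring_map_subproof x).

Fact vring_map_is_zmod : zmod_morphism vring_map.
Proof. by move=> x y; apply: val_inj; rewrite /= rmorphB. Qed.
Fact vring_map_is_monoid : monoid_morphism vring_map.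
Proof.
by split=> [|x y]; apply: val_inj; rewrite /= ?rmorph1 ?rmorphM.
Qed.

HB.instance Definition _ :=
  GRing.isZmodMorphism.Build _ _ vring_map vring_map_is_zmod.
HB.instance Definition _ :=
  GRing.isMonoidMorphism.Build _ _ vring_map vring_map_is_monoid.

End ValuationRingMap.
Arguments vring_map {R S G} f v x.

Section ValuationIdeal.
Variables (L : fieldType) (G : orderedZmodType) (v : valuation L G).
Implicit Types S T : set (withinf G).

Lemma val_eq_infty x : v x = infty <-> x = 0.
Proof.
split=> [vx|->]; last exact: val0.
apply: contrapT => /eqP x0; have := val1 v.
by rewrite -(divff x0) valM vx.
Qed.

(* The disjunct [b = 0] only matters for [S = set0]. *)
Definition videal_pred S : {pred L} :=
  fun b => `[< b = 0 \/ exists2 s, S s & s <= v b >].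

Fact videal_zmod_closed S : zmod_closed (videal_pred S).
Proof.
split=> [|x y]; first by apply/asboolP; left.
move=> /asboolP[->|[s Ss sx]] /asboolP[->|[t St ty]]; apply/asboolP.
- by left; rewrite subrr.
- by right; exists t; rewrite // sub0r valN.
- by right; exists s; rewrite // subr0.
- right; have := valB v x y.
  have /orP[vxy|vxy] := le_total (v x) (v y).
    by rewrite (min_idPl vxy) => h; exists s => //; apply: le_trans h.
  by rewrite (min_idPr vxy) => h; exists t => //; apply: le_trans h.
Qed.

HB.instance Definition _ S :=
  GRing.isZmodClosed.Build L (videal_pred S) (videal_zmod_closed S).

Record videal S : Type :=
  VIdeal { videal_val : L; _ : videal_val \in videal_pred S }.

HB.instance Definition _ S := [isSub for @videal_val S].
HB.instance Definition _ S := [Choice of videal S by <:].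
HB.instance Definition _ S := [SubChoice_isSubZmodule of videal S by <:].

Lemma videal_predZ S (u : vring v) b :
  b \in videal_pred S -> val u * b \in videal_pred S.
Proof.
move=> /asboolP[->|[s Ss sb]]; apply/asboolP; first by left; rewrite mulr0.
right; exists s => //; apply: le_trans sb _; rewrite valM.
have := valP u; rewrite /in_mem /= /vring_pred.
case: (v (val u)) (v b) => [c|] [e|] //=; rewrite /Order.le /= => c0.
by rewrite -[leLHS]add0r; apply: leg_add2r.
Qed.

Section Scale.
Variable S : set (withinf G).

Definition videal_scale (u : vring v) (b : videal S) : videal S :=
  VIdeal (videal_predZ u (valP b)).

Fact videal_scaleA a b w :
  videal_scale a (videal_scale b w) = videal_scale (a * b) w.
Proof. by apply: val_inj; rewrite /= mulrA. Qed.
Fact videal_scale1 : left_id 1 videal_scale.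
Proof. by move=> w; apply: val_inj; rewrite /= mul1r. Qed.
Fact videal_scaleDr : right_distributive videal_scale +%R.
Proof. by move=> a w w'; apply: val_inj; rewrite /= mulrDr. Qed.
Fact videal_scaleDl w : {morph videal_scale^~ w : a b / a + b}.
Proof. by move=> a b; apply: val_inj; rewrite /= mulrDl. Qed.

HB.instance Definition _ := GRing.Zmodule_isLmodule.Build (vring v) (videal S)
  videal_scaleA videal_scale1 videal_scaleDr videal_scaleDl.

End Scale.

Section Quotient.
Variables S T : set (withinf G).

Definition videal_sub : {pred videal S} := fun b => val b \in videal_pred T.

Fact videal_sub_zmod : zmod_closed videal_sub.
Proof.
by split=> [|x y]; rewrite /in_mem /= /videal_sub /= ?rpred0 //; apply: rpredB.
Qed.

HB.instance Definition _ :=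
  GRing.isZmodClosed.Build (videal S) videal_sub videal_sub_zmod.

(* This is [I_S / (I_S :&: I_T)], i.e. [I_S / I_T] whenever [I_T] is contained
   in [I_S]. *)
Definition videal_quot : Type := Quotient.quot videal_sub.

HB.instance Definition _ := EqQuotient.on videal_quot.
HB.instance Definition _ := Choice.on videal_quot.
HB.instance Definition _ := ZmodQuotient.on videal_quot.

Definition videal_class (b : videal S) : videal_quot := \pi_videal_quot b.

Lemma videal_classD b c :
  videal_class (b + c) = videal_class b + videal_class c.
Proof. exact: raddfD. Qed.

Lemma videal_class_eq b c :
  videal_class b = videal_class c <-> val b - val c \in videal_pred T.
Proof.
rewrite -[X in _ <-> is_true X]/(b - c \in videal_sub) Quotient.idealrBE.
by split=> /eqP.
Qed.

Lemma videal_class_ind (P : videal_quot -> Prop) :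
  (forall b, P (videal_class b)) -> forall x, P x.
Proof. by move=> Pc; elim/quotW. Qed.

Definition vquot_scale (u : vring v) (x : videal_quot) : videal_quot :=
  videal_class (u *: repr x).

Lemma vquot_scale_class u b :
  vquot_scale u (videal_class b) = videal_class (u *: b).
Proof.
apply/videal_class_eq; rewrite /= -mulrBr; apply: videal_predZ.
by apply/videal_class_eq; apply: reprK.
Qed.

Fact vquot_scaleA a b w : vquot_scale a (vquot_scale b w) = vquot_scale (a * b) w.
Proof.
elim/videal_class_ind: w => w.
by rewrite (vquot_scale_class b) !vquot_scale_class scalerA.
Qed.
Fact vquot_scale1 : left_id 1 vquot_scale.
Proof. by elim/videal_class_ind=> w; rewrite vquot_scale_class scale1r. Qed.
Fact vquot_scaleDr : right_distributive vquot_scale +%R.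
Proof.
move=> a; elim/videal_class_ind=> w; elim/videal_class_ind=> w'.
by rewrite -videal_classD !vquot_scale_class scalerDr videal_classD.
Qed.
Fact vquot_scaleDl w : {morph vquot_scale^~ w : a b / a + b}.
Proof.
elim/videal_class_ind: w => w a b.
by rewrite !vquot_scale_class scalerDl videal_classD.
Qed.

HB.instance Definition _ := GRing.Zmodule_isLmodule.Build (vring v) videal_quot
  vquot_scaleA vquot_scale1 vquot_scaleDr vquot_scaleDl.

End Quotient.

End ValuationIdeal.

Record is_derivation (A B : comNzRingType) (f : {rmorphism A -> B})
    (M : lmodType B) (D : B -> M) : Prop := {
  derivD : forall x y, D (x + y) = D x + D y;
  derivM : forall x y, D (x * y) = x *: D y + y *: D x;
  deriv_base : forall a, D (f a) = 0
}.

Record is_kaehler_differentials (A B : comNzRingType) (f : {rmorphism A -> B})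
    (M : lmodType B) (d : B -> M) : Prop := {
  kaehler_derivation : is_derivation f d;
  kaehler_lift : forall (N : lmodType B) (D : B -> N), is_derivation f D ->
    exists h : {linear M -> N}, forall b, h (d b) = D b;
  kaehler_unique : forall (N : lmodType B) (h k : {linear M -> N}),
    (forall b, h (d b) = k (d b)) -> forall m, h m = k m
}.

Definition finitely_generated (R : nzRingType) (M : lmodType R) : Prop :=
  exists (n : nat) (e : 'I_n -> M),
    forall x, exists c : 'I_n -> R, x = \sum_(i < n) c i *: e i.

Definition nonconstant (R : nzRingType) (f : {poly R}) : Prop := (1 < size f)%N.

Section Expansion.
Variables (K : fieldType) (q : {poly K}).

Definition qcoef (f : {poly K}) (l : nat) : {poly K} := (f %/ q ^+ l) %% q.

Lemma size_qcoef f l : nonconstant q -> (size (qcoef f l) < size q)%N.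
Proof.
move=> q1; apply: Pdiv.Field.ltn_modpN0.
by rewrite -size_poly_gt0 (ltn_trans _ q1).
Qed.

Lemma qcoef_expansion (f : {poly K}) :
  nonconstant q -> f = \sum_(l < size f) qcoef f l * q ^+ l.
Proof.
move=> q1; have q0 : q != 0 by rewrite -size_poly_gt0 (ltn_trans _ q1).
have E n : f = \sum_(l < n) qcoef f l * q ^+ l + (f %/ q ^+ n) * q ^+ n.
  elim: n => [|n IHn]; first by rewrite big_ord0 add0r expr0 divp1 mulr1.
  rewrite big_ord_recr /= -addrA /qcoef exprS.
  rewrite mulrA -mulrDl addrC [q * _]mulrC -divp_divl.
  by rewrite [X in X * _]addrC -divp_eq addrC.
rewrite [LHS](E (size f)) [f %/ _]divp_small ?mul0r ?addr0 //.
have qn0 : (0 < size (q ^+ size f))%N by rewrite size_poly_gt0 expf_neq0.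
rewrite -(prednK qn0) ltnS size_exp leq_pmull //.
by move: q1; rewrite /nonconstant; case: (size q) => [|[|m]].
Qed.

(* Zero summands of the expansion contribute the neutral value [infty]. *)
Definition truncation (G : orderedZmodType) (nu : valuation {poly K} G)
    (f : {poly K}) : withinf G :=
  \big[Order.min/infty]_(l < size f) nu (qcoef f l * q ^+ l).

End Expansion.

Definition complete_set (K : fieldType) (G : orderedZmodType)
    (nu : valuation {poly K} G) (P : set {poly K}) : Prop :=
  P `<=` @nonconstant K /\
  forall f, nonconstant f ->
    exists q, [/\ P q, (size q <= size f)%N & truncation q nu f = nu f].

Section KeyPolynomials.
Variables (K : fieldType) (Kbar : closedFieldType) (emb : {rmorphism K -> Kbar}).

Definition is_algebraic_closure : Prop := forall z, algebraicOver emb z.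

Definition extends_valuation (G G' : orderedZmodType)
    (iota : {additive G -> G'}) (nu : valuation {poly K} G)
    (nubar : valuation {poly Kbar} G') : Prop :=
  {mono iota : x y / x <= y} /\
  forall f, nubar (map_poly emb f) = inf_map iota (nu f).

Variables (G' : orderedZmodType) (nubar : valuation {poly Kbar} G').

Definition root_values (f : {poly K}) : set (withinf G') :=
  [set nubar ('X - a%:P) | a in [set a | root (map_poly emb f) a]].

(* The default [infty] of [xget] is used only for constant [f]. *)
Definition delta (f : {poly K}) : withinf G' :=
  xget infty [set m | root_values f m /\ ubound (root_values f) m].

Lemma delta_max f : nonconstant f ->
  root_values f (delta f) /\ ubound (root_values f) (delta f).
Proof.
move=> f1; pose p := map_poly emb f.
suff [m Pm] : exists m, root_values f m /\ ubound (root_values f) m.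
  by rewrite /delta; case: xgetP => [y _ //|/(_ m)].
have [r Er] := closed_field_poly_normal p.
have p0 : p != 0.
  by rewrite map_poly_eq0 -size_poly_gt0 (ltn_trans _ f1).
have rE a : root p a = (a \in r).
  by rewrite Er rootZ ?lead_coef_eq0 // root_prod_XsubC.
have : (0 < size r)%N.
  move: f1; rewrite /nonconstant -(size_map_poly emb) -/p Er.
  by rewrite size_scale ?lead_coef_eq0 // size_prod_XsubC.
have vE m : root_values f m <-> exists2 a, a \in r & nubar ('X - a%:P) = m.
  by split=> -[a]; [rewrite /= -/p rE|move=> ar]; exists a => //=; rewrite -/p rE.
move=> r0.
have [b br bmax] : exists2 b, b \in r &
    forall a, a \in r -> nubar ('X - a%:P) <= nubar ('X - b%:P).
  elim: {p p0 Er rE vE} r r0 => //= a [|b r] IH _.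
    by exists a; rewrite ?mem_head // => c; rewrite inE => /eqP->.
  have [//|c cr cmax] := IH.
  have /orP[ac|ca] := le_total (nubar ('X - a%:P)) (nubar ('X - c%:P)).
    exists c; first by rewrite inE cr orbT.
    by move=> e; rewrite inE => /predU1P[->|/cmax].
  exists a; first exact: mem_head.
  by move=> e; rewrite inE => /predU1P[->|/cmax /le_trans]//; apply.
exists (nubar ('X - b%:P)); split; first by apply/vE; exists b.
by move=> _ /vE[a ar <-]; apply: bmax.
Qed.

Definition key_polynomial (q : {poly K}) : Prop :=
  [/\ q \is monic, nonconstant q & forall f, nonconstant f ->
    delta q <= delta f -> (size q <= size f)%N].

Record complete_key_sequence (G : orderedZmodType) (nu : valuation {poly K} G)
    (g : {poly K}) (disp : Order.disp_t) (I : orderType disp) (i0 : I)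
    (Q : I -> {poly K}) : Prop := {
  cks_well_order : well_order (<=%O : rel I);
  cks_initial : forall i, (i0 <= i)%O;
  cks_key : forall i, key_polynomial (Q i);
  cks_key_last : key_polynomial g;
  cks_complete : complete_set nu (range Q `|` [set g]);
  cks_delta : forall i j, (i < j)%O -> delta (Q i) < delta (Q j);
  cks_finite : forall i, nu (Q i) < infty;
  cks_Q0 : Q i0 = 'X;
  cks_nuX : nu 'X = Fin 0
}.

End KeyPolynomials.

Section Segments.
Variables (K : fieldType) (G : orderedZmodType) (nu : valuation {poly K} G).
Variables (I : Type) (Q : I -> {poly K}) (g : {poly K}).

Definition alpha_ (i : I) : withinf G := inf_sub (nu (Q i)^`()) (nu (Q i)).
Definition beta_ (i : I) : withinf G :=
  inf_sub (nu g^`()) (truncation (Q i) nu g).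

Definition alpha : set (withinf G) := smallest (@final_segment G) (range alpha_).
Definition beta : set (withinf G) := smallest (@final_segment G) (range beta_).

End Segments.

Section Normalized.
Variables (K : fieldType) (L : fieldExtType K) (eta : L).
Variables (G : orderedZmodType) (v : valuation L G).

Definition base_val : valuation K G := val_pull (in_alg L) v.
Definition eval_val : valuation {poly K} G := val_pull (horner_alg eta) v.

Variables (I : Type) (Q : I -> {poly K}) (a : I -> K).
Hypothesis Qfin : forall i, eval_val (Q i) < infty.
Hypothesis aQ : forall i, base_val (a i) = eval_val (Q i).

Lemma val_div_a (f : {poly K}) i :
  v (horner_alg eta f / (a i)%:A) = inf_sub (eval_val f) (eval_val (Q i)).
Proof.
have := Qfin i; rewrite -aQ /= /eval_val /=; set b := (a i)%:A.
rewrite valM => vb; have b0 : b != 0.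
  by apply/eqP => b0; move: vb; rewrite b0 val0 ltxx.
have := val1 v; rewrite -(divff b0) valM.
case: (v b) (v b^-1) => [x|] [y|] //= [xy].
case: (v (horner_alg eta f)) => //= z; congr (Fin (z + _)).
by apply/eqP; rewrite -addr_eq0 addrC xy.
Qed.

Fact normalized_subproof i : horner_alg eta (Q i) / (a i)%:A \in vring_pred v.
Proof.
rewrite /in_mem /= /vring_pred val_div_a; have := Qfin i.
by case: (eval_val (Q i)) => //= x _; rewrite subrr.
Qed.

Definition normalized (i : I) : vring v := VRing (normalized_subproof i).

Fact normalized_deriv_subproof i :
  horner_alg eta (Q i)^`() / (a i)%:A \in videal_pred v (alpha eval_val Q).
Proof.
apply/asboolP; right; exists (alpha_ eval_val Q i); last by rewrite val_div_a.
by apply: sub_gen_smallest; exists i.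
Qed.

Definition normalized_deriv (i : I) : videal v (alpha eval_val Q) :=
  VIdeal (normalized_deriv_subproof i).

End Normalized.

(* Main.v *)
Require Import Defs.
From HB Require Import structures.
From mathcomp Require Import all_boot all_order all_algebra all_field.
From mathcomp Require Import boolp classical_sets wochoice.

Set Implicit Arguments.
Unset Strict Implicit.
Unset Printing Implicit Defensive.

Import Order.TTheory GRing.Theory.

Local Open Scope ring_scope.
Local Open Scope classical_set_scope.

(** Through the isomorphism with [I_alpha / I_beta], only a fact on quotients of
    valuation ideals has to be shown: if [I_S / I_T] is nonzero, it is finitely
    generated exactly when the final segment [S] has a least element.

    If [S] has a least element [m], then, as every element of [Gamma_infty] is a
    value, [I_S] is principal, generated by any element of value [m].
    Conversely, let finitely many classes generate the quotient and let [m] in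
    [S] be the least value of chosen representatives; every class then has a
    representative of value at least [m].  An element [c] with [v c] in [S] and
    [v c < m] would differ from such a representative by an element of [I_T]
    of the same value as [c].  So [I_T] would contain everything of value at
    least [v c], among it all the representatives, and the quotient would
    vanish.  Hence [m] is the least element of [S]. *)

Lemma fg_bij (R : nzRingType) (M N : lmodType R) (phi : {linear M -> N}) :
  bijective phi -> finitely_generated M <-> finitely_generated N.
Proof.
case=> psi phiK psiK; split=> -[n [e eP]]; exists n.
  exists (phi \o e) => y; have [c cE] := eP (psi y).
  by exists c; rewrite -[LHS]psiK cE linear_sum; apply: eq_bigr => i _; rewrite linearZ.
exists (psi \o e) => x; have [c cE] := eP (phi x).
exists c; apply: (can_inj phiK); rewrite cE linear_sum.
by apply: eq_bigr => i _; rewrite linearZ /= psiK.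
Qed.

Lemma final_smallest (G : orderedZmodType) (S : set (withinf G)) :
  final_segment (smallest (@final_segment G) S).
Proof. by move=> x y Sx xy F FS; exact: FS.1 (Sx F FS) xy. Qed.

Lemma inf_leEinfty (G : orderedZmodType) (x : withinf G) : x <= infty.
Proof. by case: x. Qed.

Section QuotientOfIdeals.
Variables (L : fieldType) (G : orderedZmodType) (v : valuation L G).
Implicit Types S T : set (withinf G).

Lemma val_scale_ge (u : vring v) (b : L) : v b <= v (val u * b).
Proof.
rewrite Defs.valM; have := valP u; rewrite /in_mem /= /vring_pred.
case: (v (val u)) (v b) => [c|] [e|] //=; rewrite /Order.le /= => c0.
by rewrite -[leLHS]add0r; apply: leg_add2r.
Qed.

Lemma divr_vring (b c : L) : b != 0 -> v b <= v c -> c / b \in vring_pred v.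
Proof.
move=> b0; have := congr1 v (divff b0); rewrite Defs.val1 Defs.valM.
rewrite /in_mem /= /vring_pred Defs.valM.
case: (v b) (v b^-1) (v c) => [x|] [y|] [z|] //= [xy]; rewrite /Order.le /=.
by move=> xz; rewrite -xy; apply: leg_add2r.
Qed.

Lemma videal_mem_val S (b : videal v S) :
  final_segment S -> S infty -> S (v (val b)).
Proof.
move=> Sf Si; have /asboolP[->|[s Ss sb]] := valP b; first by rewrite Defs.val0.
exact: Sf sb.
Qed.

Lemma videal_mem_ge T (b c : L) :
  b \in videal_pred v T -> v b <= v c -> c \in videal_pred v T.
Proof.
move=> /asboolP[->|[t Tt tb]] bc; apply/asboolP; last first.
  by right; exists t => //; apply: le_trans bc.
left; apply/(val_eq_infty v)/le_anti.
by rewrite inf_leEinfty -(Defs.val0 v).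
Qed.

Lemma videal_class0 S T : videal_class T (0 : videal v S) = 0.
Proof. by apply: (addIr (videal_class T 0)); rewrite -videal_classD !add0r. Qed.

Lemma videal_class_eq0 S T (b : videal v S) :
  val b \in videal_pred v T -> videal_class T b = 0.
Proof.
by move=> bT; rewrite -(videal_class0 S T); apply/videal_class_eq; rewrite /= subr0.
Qed.

(** The classes that have a representative of value at least [m] form a
    submodule, so it suffices that the generators have one. *)
Lemma span_representative S T n (b : 'I_n -> videal v S) m :
  (forall i, m <= v (val (b i))) ->
  forall c : 'I_n -> vring v,
  exists2 z : videal v S, \sum_(i < n) c i *: videal_class T (b i) = videal_class T z
    & m <= v (val z).
Proof.
move=> mb c; elim/big_ind: _ => [|x y [zx -> mx] [zy -> my]|i _].
- by exists 0; rewrite ?Defs.val0 ?inf_leEinfty //; rewrite videal_class0.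
- exists (zx + zy); first by rewrite videal_classD.
  by apply: le_trans (Defs.valD v _ _); rewrite le_min mx.
- exists (c i *: b i); first exact: vquot_scale_class.
  exact: le_trans (mb i) (val_scale_ge _ _).
Qed.

Lemma fg_of_least S T :
  range v = setT -> has_least S -> finitely_generated (videal_quot v S T).
Proof.
move=> vL [m Sm mS]; have [b _ bm] : range v m by rewrite vL.
have bS : b \in videal_pred v S by apply/asboolP; right; exists m; rewrite ?bm.
exists 1%N, (fun=> videal_class T (VIdeal bS)).
elim/videal_class_ind=> z; have zb : v b <= v (val z).
  have /asboolP[->|[s Ss sz]] := valP z; first by rewrite Defs.val0 inf_leEinfty.
  by rewrite bm; apply: le_trans sz; apply: mS.
have [b0|b0] := eqVneq b 0.
  (* Here [m] is infinite, so that [I_S] is zero. *)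
  exists (fun=> 0); rewrite big_ord1 scale0r.
  have z0 : val z = 0.
    by apply/(val_eq_infty v)/le_anti; rewrite inf_leEinfty -(Defs.val0 v) -b0.
  by apply: videal_class_eq0; rewrite z0 rpred0.
exists (fun=> VRing (divr_vring b0 zb)); rewrite big_ord1.
rewrite [RHS]vquot_scale_class; congr videal_class.
by apply: val_inj; rewrite /= divfK.
Qed.

Lemma least_of_fg S T :
  range v = setT -> final_segment S -> (exists w : videal_quot v S T, w != 0) ->
  finitely_generated (videal_quot v S T) -> has_least S.
Proof.
move=> vL Sf [w w0] [n [e eP]].
have Si : S infty.
  elim/videal_class_ind: w w0 => z z0.
  have /asboolP[zE|[s Ss _]] := valP z; last exact: Sf Ss (inf_leEinfty s).
  by case/eqP: z0; apply: videal_class_eq0; rewrite zE rpred0.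
pose b i := repr (e i); have bE i : videal_class T (b i) = e i by apply: reprK.
pose m := \big[Order.min/infty]_(i < n) v (val (b i)).
have mb i : m <= v (val (b i)) by rewrite /m (bigD1 i) //= ge_min lexx.
exists m.
  rewrite /m; elim/big_ind: _ => [//|x y Sx Sy|i _]; last exact: videal_mem_val.
  by rewrite minEle; case: ifP.
move=> x Sx; rewrite leNgt; apply/negP => xm.
have [c _ cx] : range v x by rewrite vL.
have cS : c \in videal_pred v S by apply/asboolP; right; exists x; rewrite ?cx.
have [u] := eP (videal_class T (VIdeal cS)).
under eq_bigr do rewrite -bE.
have [z -> mz /videal_class_eq /= tT] := span_representative T mb u.
(* [v z > v c], and the value of a sum is at least the smaller one. *)
have tx : v (c - val z) <= x.
  have := Defs.valD v (c - val z) (val z); rewrite subrK cx ge_min.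
  by case/orP => // zx; have := lt_le_trans xm (le_trans mz zx); rewrite ltxx.
have bT i : e i = 0.
  rewrite -bE; apply: videal_class_eq0; apply: videal_mem_ge tT _.
  exact: le_trans tx (le_trans (ltW xm) (mb i)).
case/eqP: w0; have [k ->] := eP w.
by apply: big1 => i _; rewrite bT scaler0.
Qed.

End QuotientOfIdeals.

Theorem proposition4p8
    (K : fieldType) (L : fieldExtType K) (eta : L) (g : {poly K})
    (Gamma : orderedZmodType) (v : valuation L Gamma)
    (Leta : <<1; eta>>%VS = fullv)
    (gmin : map_poly (in_alg L) g = minPoly 1%VS eta)
    (vL : range v = setT)
    (vLK : range v = range (base_val v))
    (Kbar : closedFieldType) (emb : {rmorphism K -> Kbar})
    (Kbar_alg : is_algebraic_closure emb)
    (Gamma' : orderedZmodType) (iota : {additive Gamma -> Gamma'})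
    (nubar : valuation {poly Kbar} Gamma')
    (nubar_ext : extends_valuation emb iota (eval_val eta v) nubar)
    (disp : Order.disp_t) (I : orderType disp) (i0 : I) (Q : I -> {poly K})
    (Qseq : complete_key_sequence emb nubar (eval_val eta v) g i0 Q)
    (a : I -> K) (a0 : a i0 = 1)
    (aQ : forall i, base_val v (a i) = eval_val eta v (Q i))
    (Omega : lmodType (vring v)) (d : vring v -> Omega)
    (Omega_kaehler : is_kaehler_differentials (vring_map (in_alg L) v) d)
    (Omega_iso : exists phi : {linear Omega ->
        videal_quot v (alpha (eval_val eta v) Q) (beta (eval_val eta v) Q g)},
      bijective phi /\
      forall i, phi (d (normalized (cks_finite Qseq) aQ i)) =
                videal_class _ (normalized_deriv (cks_finite Qseq) aQ i))
    (Omega_neq0 : exists w : Omega, w != 0) :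
  finitely_generated Omega <-> has_least (alpha (eval_val eta v) Q).
Proof.
have [phi [phib _]] := Omega_iso; rewrite (fg_bij phib); split; last exact: fg_of_least.
apply: least_of_fg => //; first exact: final_smallest.
have [w w0] := Omega_neq0; exists (phi w); apply: contra w0 => /eqP pw.
by apply/eqP/(bij_inj phib); rewrite pw linear0.
Qed.
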